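(* Let $X$ be a locally compact, non-compact Hausdorff space, with one-point compactification $\alpha X = X \cup \{\star\}$. Then $\alpha X$ is radial at $\star$ if and only if there exists a collection $\mathcal{S} \subseteq \overline{\mathbf{Sp}}^\infty(X)$ such that for all $C \in \prod_{S \in \mathcal{S}} \mathcal{K}(S)$, the set $\bigcup_{S \in \mathcal{S}} (S \setminus C(S))$ has co-compact interior in $X$.
   Context: A transfinite sequence is a net whose domain is (nonempty and) well-ordered. A space $Z$ is radial at $z$ if for every $A \subseteq Z$ with $z \in \overline{A}$ there is a transfinite sequence with range in $A$ converging to $z$. A spoke at a point $z$ of $Z$ is a subspace $S \ni z$ of $Z$ such that $z$ has, in $S$, a neighbourhood base well-ordered by $\supseteq$. $\star$ denotes the point at infinity of the one-point compactification $\alpha X$. A set $S \subseteq X$ is a spoke at infinity of $X$ if $S \cup \{\star\}$ is a spoke at $\star$ in $\alpha X$; $\overline{\mathbf{Sp}}^\infty(X)$ is the set of spokes at infinity that are closed in $X$. $\mathcal{K}(S)$ is the set of compact subsets of $S$. A subset of $X$ is co-compact if its complement in $X$ is compact. *)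

(* Defs.v *)
From mathcomp Require Import all_boot.
From mathcomp Require Import wochoice all_classical.
From mathcomp Require Import topology.

Set Implicit Arguments.
Unset Strict Implicit.
Unset Printing Implicit Defensive.

Local Open Scope classical_set_scope.

(* Filter of tails of a directed preorder: a net [f] on [(I, R)] converges to
   [z] iff [f @ tails R --> z]. *)
Definition tails (I : Type) (R : rel I) : set_system I :=
  filter_from [set: I] (fun i => [set j | R i j]).

(* [well_order R] (every nonempty subset has a unique [R]-minimum)
   already entails that [R] is reflexive, antisymmetric, transitive and total. *)
Definition radial_at (Z : topologicalType) (z : Z) : Prop :=
  forall A : set Z, closure A z ->
    exists (I : Type) (R : rel I) (f : I -> Z),
      [/\ [set: I] !=set0, well_order R, range f `<=` A & f @ tails R --> z].

(* [subspace S] keeps the carrier [Z], so its neighbourhoods may stick out of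
   [S]; the inclusions in [S] restrict to subsets of the actual subspace. *)
Definition nbhs_base_in (Z : topologicalType) (S : set Z) (z : Z)
    (B : set (set Z)) : Prop :=
  (forall U, B U -> U `<=` S /\ nbhs (z : subspace S) U) /\
  (forall V, V `<=` S -> nbhs (z : subspace S) V -> exists2 U, B U & U `<=` V).

(* Well-ordering of a family of sets by reverse inclusion: the minimum of a
   nonempty subfamily is its largest member. *)
Definition well_ordered_by_supset (T : Type) (B : set (set T)) : Prop :=
  wo_chain (fun U V : set T => `[< V `<=` U >]) (mem B).

Definition spoke_at (Z : topologicalType) (z : Z) (S : set Z) : Prop :=
  S z /\ exists B, nbhs_base_in S z B /\ well_ordered_by_supset B.

Definition infty (X : topologicalType) : one_point_compactification X := None.

Definition spoke_at_infinity (X : topologicalType) (S : set X) : Prop :=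
  spoke_at (infty X) ((Some @` S) `|` [set infty X]).

Definition closed_spokes_at_infinity (X : topologicalType) : set (set X) :=
  [set S | spoke_at_infinity S /\ closed S].
Arguments closed_spokes_at_infinity X : clear implicits.

Definition compact_subsets (X : topologicalType) (S : set X) : set (set X) :=
  [set K | compact K /\ K `<=` S].

Definition co_compact (X : topologicalType) (A : set X) : Prop :=
  compact (~` A).

(* Main.v *)
(* Two facts hold in any regular T1 space [Z]. A spoke at [z] whose trace on [A]
   clusters at [z] contains a transfinite sequence in [A] converging to [z], got
   by picking a point of [A] in each member of the neighbourhood base.
   Conversely, if [Z] is radial at [z], take a converging transfinite sequence
   [s] in [A] of least length: [z] is not in the closure of any proper initial
   segment, so the closures of the tails of [s] form a neighbourhood base of [z]
   in the closure of [s], which is therefore a closed spoke.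

   In the compactification, [infty X] is in the closure of [Y] exactly when [Y]
   is not relatively compact. If the point is radial, take all closed spokes:
   were the complement of a union of the [S `\` C S] not relatively compact, a
   closed spoke [S] would meet it in a set that is not relatively compact, yet
   contained in [C S]. Conversely, if [A] met every spoke of the collection in a
   relatively compact set, then choosing [C S] to be the closure of [A `&` S]
   would show that [A] is relatively compact. *)
Require Import Defs.
From mathcomp Require Import all_boot.
From mathcomp Require Import wochoice all_classical.
From mathcomp Require Import topology.

Local Open Scope classical_set_scope.

Section WellOrder.
Context {I : Type} {R : rel I} (R_wo : well_order R).

Lemma well_order_min (P : set I) : P !=set0 ->
  exists2 m, P m & forall x, P x -> R m x.
Proof.
move=> [x Px]; have [|m [[Pm mP] _]] := R_wo (mem P).
  by exists x; apply/mem_set.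
by exists m => [|y Py]; [exact: set_mem Pm|apply/mP/mem_set].
Qed.

Lemma well_order_total : total R.
Proof.
move=> x y; have [|m mxy mP] := @well_order_min [set x; y].
  by exists x; left.
by case: mxy mP => -> mP; rewrite mP ?orbT//; [right|left].
Qed.

Lemma well_order_refl : reflexive R.
Proof. by move=> x; have := well_order_total x x; rewrite orbb. Qed.

(** Both points are minima of the pair, and minima are unique. *)
Lemma well_order_anti : antisymmetric R.
Proof.
move=> x y /andP[xy yx].
have refl := well_order_refl.
have [|m [_ mU]] := R_wo (mem [set x; y]).
  by exists x; apply/mem_set; left.
by rewrite -(mU x) ?(mU y)//;
  split=> [|t /set_mem[]->//]; apply/mem_set; [right|left].
Qed.

Lemma well_order_trans : transitive R.
Proof.
move=> y x z xy yz; have [|m mxyz mP] :=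
    @well_order_min [set t | [\/ t = x, t = y | t = z]].
  by exists x; apply: Or31.
case: mxyz => em; rewrite em in mP.
- by apply: mP; apply: Or33.
- have <- // : y = x by apply: well_order_anti; rewrite xy mP//; apply: Or31.
- by have -> : z = y by apply: well_order_anti; rewrite yz mP//; apply: Or32.
Qed.

End WellOrder.

Section Spokes.
Context {Z : topologicalType}.
Implicit Types (z : Z) (A S : set Z).

Lemma nbhs_subspaceE z S U : S z ->
  nbhs (z : subspace S) U <-> within S (nbhs z) U.
Proof. by move=> Sz; rewrite /nbhs/= -nbhs_subspace_in. Qed.

Lemma spoke_transfinite z S A : spoke_at z S -> closure (A `&` S) z ->
  exists (I : Type) (R : rel I) (f : I -> Z),
    [/\ [set: I] !=set0, well_order R, range f `<=` A & f @ tails R --> z].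
Proof.
move=> [Sz [B [[BS SB] B_wo]]] clA.
have nbhsS U := nbhs_subspaceE z S U Sz.
(* The base itself, ordered by reverse inclusion, indexes the sequence. *)
pose R : rel (set_type B) := fun U V => `[< \val V `<=` \val U >].
have pick (U : set_type B) : exists x, A x /\ \val U x.
  have [US /nbhsS zU] := BS _ (set_valP U).
  by have [x [[Ax Sx] Ux]] := clA _ zU; exists x; split=> //; exact: Ux.
have [f fP] := choice pick.
exists (set_type B), R, f; split.
- have [//||U BU _] := SB S; first by apply/nbhsS; exact: withinT.
  by exists (SigSub (mem_set BU)).
- apply: antisymmetric_well_order => [U V|P [U PU]].
    by move=> /andP[/asboolP VU /asboolP UV]; apply/val_inj/seteqP.
  have [V /set_mem/= BPV||_ [[/set_mem[W PW <-] Wmin] _]] :=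
      B_wo (mem (\val @` [set` P])).
  + by case: BPV => W _ <-; apply/mem_set/set_valP.
  + by exists (\val U); apply/mem_set; exists U.
  + by exists W; split=> // V PV; apply: Wmin; apply/mem_set; exists V.
- by move=> _ [U _ <-]; exact: (fP U).1.
- move=> N zN; have [||U BU UN] := SB (N `&` S).
  + exact: subIsetr.
  + by apply/nbhsS; apply: filterS zN => x Nx Sx.
  exists (SigSub (mem_set BU)) => // V /asboolP VU.
  by have [] := UN _ (VU _ (fP V).2).
Qed.

(* Minimizing over all maps [f], and not only over the subsets of [A], plays the
   role of taking a converging sequence of least length: it needs no ordinals
   and also applies to the reindexing [s] built in [radial_closed_spoke]. *)
Lemma minimal_index z A (R : rel Z) : accessible_space Z -> well_order R ->
  closure A z -> ~ A z ->
  exists (W : set Z) (f : Z -> Z), closure (A `&` f @` W) z /\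
    forall d g, W d -> ~ closure (A `&` g @` [set x | R x d]) z.
Proof.
move=> T1 R_wo clA nAz.
pose D := [set d | exists g, closure (A `&` g @` [set x | R x d]) z].
have [[d0 Dd0]|D0] := pselect (D !=set0); last first.
  exists setT, id; split=> [|d g _ ?]; last by apply: D0; exists d, g.
  by rewrite image_id setIT.
have [|d [f fd] dmin] := well_order_min R_wo D; first by exists d0.
exists [set x | ~~ R d x], f; split; last first.
  by move=> x g /negP ndx xg; apply/ndx/dmin; exists g.
(* Dropping the one value [f d] keeps [z] in the closure: singletons are closed, so otherwise [z]
   would equal [f d] and lie in [A]. *)
have : closure ((A `&` f @` [set x | ~~ R d x]) `|` (A `&` [set f d])) z.
  apply: closureS fd => _ [/[swap] [[x xd <-]] Ax].
  have [dx|] := boolP (R d x); last by left; split=> //; exists x.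
  by right; split=> //=; congr f; apply: (well_order_anti R_wo); rewrite xd dx.
rewrite closureU => -[//|zfd].
have [x [[Ax xfd] _]] := zfd _ filterT.
have /closureI[_] := zfd.
rewrite -(iffLR (closure_id _) (@accessible_closed_set1 _ T1 (f d))) => zfd'.
by case: nAz; rewrite zfd' -xfd.
Qed.

Lemma radial_closed_spoke z A :
  accessible_space Z -> {for z, regular_space Z} ->
  radial_at z -> closure A z -> ~ A z ->
  exists S, [/\ closed S, spoke_at z S & closure (A `&` S) z].
Proof.
move=> T1 Zreg Zrad clA nAz.
have [R R_wo] := well_ordering_principle Z.
have [W [f [clW Wmin]]] := minimal_index z A R T1 R_wo clA nAz.
have [J [RJ [g [[j0 _] RJ_wo gAW gz]]]] := Zrad _ clW.
have fW j : exists x, W x /\ f x = g j.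
  by have [_ [x Wx <-]] := gAW _ (imageT g j); exists x.
have [h hP] := choice fW.
have gA j : A (g j) by have [] := gAW _ (imageT g j).
(* Were [h] to return below [d] in every tail, these terms of [g] would cluster at [z] inside the
   image of a segment that [Wmin] excludes. Off [W], [j0] is a dummy. *)
have past d : exists k, W d -> forall j, RJ k j -> ~~ R (h j) d.
  have [Wd|nWd] := pselect (W d); last by exists j0.
  apply: contrapT => nk; apply: (Wmin d f Wd) => N /gz[k _ kN].
  have [j [kj hjd]] : exists j, RJ k j /\ R (h j) d.
    apply: contrapT => nj; apply: nk; exists k => _ j kj; apply/negP => hjd.
    by apply: nj; exists j.
  exists (g j); split; last exact: kN.
  by split; [exact: gA|exists (h j) => //; exact: (hP j).2].
have [k kP] := choice past.
pose s d := g (k d).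
have s_cvg N : nbhs z N ->
    exists2 d0, W d0 & forall d, W d -> R d0 d -> N (s d).
  (* The bound [h j] works: if [k d] preceded [j], [past] would put [h j] strictly above [d]. *)
  move=> /gz[j _ jN]; exists (h j) => [|d Wd hjd]; first exact: (hP j).1.
  apply: jN; have /orP[//|kdj] := well_order_total RJ_wo j (k d).
  by have := kP d Wd j kdj; rewrite hjd.
have s_init d : W d -> ~ closure (s @` [set x | R x d]) z.
  move=> Wd; have := Wmin d s Wd; apply: contra_not.
  by apply: closureS => _ [x xd <-]; split; [exact: gA|exists x].
pose T d := closure (s @` (W `&` [set x | R d x])).
have Tz d : W d -> T d z.
  move=> Wd N /s_cvg[d0 Wd0 d0N].
  have /orP[dd0|d0d] := well_order_total R_wo d d0.
    exists (s d0); split; first by exists d0.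
    by apply: d0N => //; exact: (well_order_refl R_wo).
  exists (s d); split; last exact: d0N.
  by exists d => //; split=> //; exact: (well_order_refl R_wo).
have TS d : T d `<=` closure (s @` W).
  by apply: closureS => _ [x [Wx _] <-]; exists x.
have Sz : closure (s @` W) z.
  by apply: (TS (h j0)); apply: Tz; exact: (hP j0).1.
exists (closure (s @` W)); split; first exact: closed_closure.
- split=> //; exists (T @` W).
  have nbhsS U := nbhs_subspaceE z (closure (s @` W)) U Sz.
  split; [split=> [_ [d Wd <-]|V VS /nbhsS zV]|].
  + split; first exact: TS.
    apply/nbhsS; rewrite /within/=.
    (* The spoke is the union of [T d] and the closure of the segment up to [d]; the latter misses
       [z]. *)
    have : nbhs z (~` closure (s @` [set x | R x d])).
      apply: open_nbhs_nbhs; split; last exact: s_init.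
      exact/closed_openC/closed_closure.
    apply: filterS => x nx Sx.
    suff : closure (s @` [set x | R x d] `|` s @` (W `&` [set x | R d x])) x.
      by rewrite closureU => -[].
    apply: closureS Sx => _ [t Wt <-].
    by have /orP[td|dt] := well_order_total R_wo t d; [left|right]; exists t.
  + have [N zN NV] := Zreg _ zV.
    have [d0 Wd0 d0N] := s_cvg _ zN.
    exists (T d0); first by exists d0.
    move=> x Tx; apply: NV; last exact: TS Tx.
    by apply: closureS Tx => _ [t [Wt d0t] <-]; exact: d0N.
  + apply: antisymmetric_wo_chain => [U V _ _ /andP[/asboolP VU /asboolP UV]|].
      by apply/seteqP.
    move=> P PB [U PU].
    (* [T] is decreasing, so the least index yields the largest member of [P]. *)
    have [|d [Wd PTd] dmin] := well_order_min R_wo [set d | W d /\ T d \in P].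
      by have /set_mem[d Wd TU] := PB _ PU; exists d; split=> //; rewrite TU.
    exists (T d); split=> // V PV; have /set_mem[e We eV] := PB _ PV.
    apply/asboolP; rewrite -eV; apply: closureS => _ [x [Wx ex] <-].
    exists x => //; split=> //; apply: (well_order_trans R_wo) ex.
    by apply: dmin; split=> //; rewrite eV.
- apply: closureS Sz => _ [d Wd <-]; split; first exact: gA.
  by apply: subset_closure; exists d.
Qed.

End Spokes.

(** Basic neighbourhoods of infinity are complements of closed compact sets [K], and such a
    neighbourhood misses [Y] exactly when [K] contains [Y]. *)
Lemma closure_infty (X : topologicalType) (Y : set X) : hausdorff_space X ->
  closure (Some @` Y : set (one_point_compactification X)) (infty X) <->
  ~ compact (closure Y).
Proof.
move=> X_T2; split=> [clY cY|ncY N [K [cK clK] KN]].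
  have [|x []] := clY (Some @` (~` closure Y) `|` [set None]).
    by exists (closure Y) => //; split=> //; exact: closed_closure.
  by move=> [y Yy <-] [[y' + [y'y]]|//]; rewrite y'y => /(_ (subset_closure Yy)).
have [x [Yx nKx]] : exists x, Y x /\ ~ K x.
  apply: contrapT => nx; apply: ncY; apply: (subclosed_compact _ cK).
    exact: closed_closure.
  rewrite (iffLR (closure_id _) clK); apply: closureS => x Yx.
  by apply: contrapT => nKx; apply: nx; exists x.
by exists (Some x); split; [exists x|apply: KN; left; exists x].
Qed.

Theorem theorem2p4 (X : topologicalType)
    (X_lc : locally_compact [set: X])
    (X_nc : ~ compact [set: X])
    (X_T2 : hausdorff_space X) :
  radial_at (infty X) <->
  exists SS : set (set X),
    SS `<=` closed_spokes_at_infinity X /\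
    forall C : set X -> set X,
      (forall S, SS S -> compact_subsets S (C S)) ->
      co_compact (interior (\bigcup_(S in SS) (S `\` C S))).
Proof.
have sub_compact (Y K : set X) : compact K -> Y `<=` K -> compact (closure Y).
  move=> cK YK; apply: (subclosed_compact _ cK); first exact: closed_closure.
  by rewrite (iffLR (closure_id _) (compact_closed X_T2 cK)); exact: closureS.
have aX_T2 := one_point_compactification_hausdorff X_lc X_T2.
split=> [aX_rad|[SS [SS_sp SS_co]] A clA].
- exists (closed_spokes_at_infinity X); split=> // C CP.
  rewrite /co_compact -closure_setC; apply: contrapT.
  move=> /(closure_infty _ _ X_T2) clU.
  set U := \bigcup_(S in _) _ in clU.
  have [||S [cS [Sz S_sp] clAS]] :=
      radial_closed_spoke _ _ (hausdorff_accessible aX_T2) _ aX_rad clU.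
  + apply: (compact_regular aX_T2 one_point_compactification_compact).
    exact: filterT.
  + by case.
  pose S' : set X := Some @^-1` S.
  have S'E : Some @` S' `|` [set infty X] = S.
    apply/seteqP; split=> [_ [[x Sx <-]//|->//]|[x|] Sx]; last by right.
    by left; exists x.
  have S'_sp : closed_spokes_at_infinity X S'.
    split; first by rewrite /spoke_at_infinity S'E; split.
    apply: preimage_closed cS => x _.
    exact: one_point_compactification_some_continuous.
  have [cC CS] := CP _ S'_sp.
  have : closure (Some @` C S' : set (one_point_compactification X)) (infty X).
    apply: closureS clAS => _ [[x nUx <-] Sx]; exists x => //.
    by apply: contrapT => nCx; apply: nUx; exists S'.
  by move=> /(closure_infty _ _ X_T2); apply; exact: sub_compact cC _.
- have [Az|nAz] := pselect (A (infty X)).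
    (* A constant sequence of length one suffices. *)
    exists unit, (fun _ _ => true), (fun _ => infty X); split.
    + by exists tt.
    + by move=> P [[] Pt]; exists tt; split=> [|[]].
    + by move=> _ [_ _ <-].
    + by move=> N zN; exists tt => // x _; exact: nbhs_singleton.
  pose Y : set X := Some @^-1` A.
  have YE : Some @` Y = A.
    by apply/seteqP; split=> [_ [x Ax <-]//|[x|] // Ax]; exists x.
  have [S SS_S clYS] : exists2 S, SS S & ~ compact (closure (Y `&` S)).
    apply: contrapT => nS.
    have cYS S : SS S -> compact (closure (Y `&` S)).
      by move=> SSS; apply: contrapT => nc; apply: nS; exists S.
    move: clA; rewrite -YE => /(closure_infty _ _ X_T2); apply.
    have /SS_co : forall S, SS S -> compact_subsets S (closure (Y `&` S)).
      move=> S SSS; split; first exact: cYS.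
      rewrite [X in _ `<=` X](iffLR (closure_id _) (SS_sp _ SSS).2).
      by apply: closureS => x [].
    (* [Y] avoids the interior: a point of [Y] in some [S] belongs to the set removed from [S]. *)
    move=> /sub_compact; apply=> x Yx /interior_subset[S SSS [Sx]]; apply.
    by apply: subset_closure.
  apply: (spoke_transfinite _ _ _ (SS_sp _ SS_S).1).
  move/(closure_infty _ _ X_T2): clYS; apply: closureS => _ [x [Yx Sx] <-].
  by split=> //; left; exists x.
Qed.
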